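(* Let $f:\mathbb{R}^n\to\mathbb{R}$ be a continuous convex function and let $g:\mathbb{R}^n\to\mathcal{Y}$ be a continuous mapping such that the set-valued mapping $G_K(x)=-g(x)+K$ is graph-convex. If for every $h_x\in\mathbb{R}^n$ $$0\in G_K^{\infty}(h_x)\ \Longrightarrow\ h_x=0,$$ then the set of feasible shifts $\mathcal{S}$ is a closed set in $\mathcal{Y}$.
   Context: $\mathcal{Y}$ is a finite dimensional Hilbert space and $K\subset\mathcal{Y}$ is a nonempty closed convex set. $G_K:\mathbb{R}^n\rightrightarrows\mathcal{Y}$, $G_K(x):=-g(x)+K$, is called graph-convex if its graph $\mathrm{gph}\,G_K=\{(x,y)\in\mathbb{R}^n\times\mathcal{Y}: y\in -g(x)+K\}=\{(x,y): g(x)+y\in K\}$ is a convex set. $G_K^{\infty}:\mathbb{R}^n\rightrightarrows\mathcal{Y}$ is the set-valued mapping whose graph is the horizon (recession) cone $(\mathrm{gph}\,G_K)^{\infty}$ of $\mathrm{gph}\,G_K$, i.e. $h_s\in G_K^\infty(h_x)$ iff $(h_x,h_s)\in(\mathrm{gph}\,G_K)^\infty$. The set of feasible shifts is $\mathcal{S}:=\{s\in\mathcal{Y}: \text{there exists } x\in\mathbb{R}^n \text{ such that } g(x)+s\in K\}$. *)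

(* Defs.v *)
From HB Require Import structures.
From mathcomp Require Import all_boot all_order all_algebra.
From mathcomp Require Import all_classical all_reals all_analysis.
Import Order.TTheory GRing.Theory Num.Theory.
Import numFieldNormedType.Exports.

Set Implicit Arguments.
Unset Strict Implicit.
Unset Printing Implicit Defensive.

Local Open Scope classical_set_scope.
Local Open Scope ring_scope.

(* {dot T for idfun} is the type of real inner products: bilinear, symmetric,
   positive definite forms. *)
HB.mixin Record NormedModule_isHilbert (R : realType) T
    & NormedModule R T := {
  inner : {dot T for (@idfun R)} ;
  inner_normE : forall x : T, inner x x = `|x| ^+ 2
}.

#[short(type="hilbertType")]
HB.structure Definition Hilbert (R : realType) :=
  {T of NormedModule_isHilbert R T & CompleteNormedModule R T}.

#[short(type="finHilbertType")]
HB.structure Definition FinHilbert (R : realType) :=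
  {T of Hilbert R T & Vector R T}.

Section SetValued.
Context {R : realType} {E F : normedModType R}.

Definition gph (G : E -> set F) : set (E * F) := [set p | G p.1 p.2].

Definition graph_convex (G : E -> set F) : Prop :=
  @convex_set R (E * F)%type (gph G).

End SetValued.

(* The horizon cone in the sense of Rockafellar and Wets: limits of
   lambda_k *: c_k with c_k in C and lambda_k > 0 tending to 0, with the
   convention that the horizon cone of the empty set is {0}.  On nonempty
   closed convex sets it coincides with the recession cone. *)
Definition horizon_cone {R : realType} {E : normedModType R}
    (C : set E) : set E :=
  [set w | (C = set0 /\ w = 0) \/
     exists (c : E^nat) (lambda : R^nat),
       [/\ forall k, C (c k),
           forall k, 0 < lambda k,
           lambda k @[k --> \oo] --> (0 : R) &
           lambda k *: c k @[k --> \oo] --> w]].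

Definition horizon_map {R : realType} {E F : normedModType R}
    (G : E -> set F) : E -> set F :=
  fun h => [set s | horizon_cone (gph G) (h, s)].

Section Shifts.
Context {R : realType} {E F : normedModType R}.
Variables (g : E -> F) (K : set F).

Definition GK : E -> set F := fun x => [set - g x + k | k in K].

Definition feasible_shifts : set F := [set s | exists x, K (g x + s)].

End Shifts.

(* Main.v *)
Require Import Defs.
From HB Require Import structures.
From mathcomp Require Import all_boot all_order all_algebra.
From mathcomp Require Import all_classical all_reals all_analysis.
Import Order.TTheory GRing.Theory Num.Theory.
Import numFieldNormedType.Exports.
Local Open Scope classical_set_scope.
Local Open Scope ring_scope.

(** The set of feasible shifts is the projection on the second factor of
    [gph (GK g K)], which is the set of pairs [(x, s)] with [g x + s] in [K].
    That graph is closed, being the preimage of the closed set [K] under a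
    continuous map.  Projections of closed sets need not be closed, because the
    fibre points [x] may escape to infinity while [s] converges.  The horizon
    hypothesis forbids this: if [x_k] escapes along pairs [(x_k, s_k)] of the
    graph with [s_k] bounded, then rescaling by [1 / |x_k|] and extracting a
    limit on the compact unit sphere of R^n yields a horizon direction [(h, 0)]
    with [|h| = 1] ([horizon_cone_unbounded]).  Hence the [x_k] stay bounded, a
    subsequence converges, and its limit is a preimage of the limit shift
    ([closed_image_snd]). *)

(** Instead of strict monotonicity of the extraction, [k <= phi k] is recorded:
    it is what makes [phi] tend to infinity, hence what is needed to pass to
    the subsequence in other convergent sequences. *)
Lemma bounded_cvg_subsequence (R : realType) (n : nat) (u : nat -> 'rV[R]_n)
    (M : R) :
  (forall k, `|u k| <= M) ->
  exists (phi : nat -> nat) (l : 'rV[R]_n),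
    (forall k, (k <= phi k)%N) /\ u (phi k) @[k --> \oo] --> l.
Proof.
move=> uM; pose A := [set x : 'rV[R]_n | `|x| <= M].
have Acompact : compact A.
  apply: bounded_closed_compact.
    by exists M; split; [exact: num_real|move=> B /ltW MB x /le_trans; exact].
  apply: (@preimage_closed _ _ (fun x : 'rV[R]_n => `|x|) [set y : R | y <= M]).
    by move=> x _; exact: norm_continuous.
  exact: closed_le.
have [|l [_ lcl]] := Acompact (u @ \oo) _; first by exists 0%N => // k _; exact: uM.
have near_l k : exists m, (k <= m)%N /\ `|l - u m| < k.+1%:R^-1.
  have /(_ [set u m | m in [set m | (k <= m)%N]]) := lcl.
  move=> /(_ (ball l k.+1%:R^-1)) [||_ [[m km <-]] +].
  - by exists k => // m /= km; exists m.
  - by apply: nbhsx_ballx; rewrite invr_gt0.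
  - by rewrite -ball_normE => lm; exists m.
have [phi phiP] := choice near_l.
exists phi, l; split=> [k|]; first by have [] := phiP k.
apply/cvgrPdist_lt => e e0; near=> k.
have [_ /lt_trans] := phiP k; apply.
by near: k; exact: near_infty_natSinv_lt (PosNum e0).
Unshelve. all: by end_near. Qed.

Lemma cvg_geq_id (phi : nat -> nat) :
  (forall k, (k <= phi k)%N) -> phi k @[k --> \oo] --> \oo.
Proof.
by move=> phi_ge A [N _ NA]; exists N => // k /= /leq_trans Nk; exact/NA/Nk.
Qed.

(** The unit vectors [x_k / |x_k|] have a limit [h] along a subsequence, and the
    bounded components, divided by [|x_k|], vanish in the limit. *)
Lemma horizon_cone_unbounded (R : realType) (n : nat) (F : normedModType R)
    (C : set ('rV[R]_n * F)) (c : nat -> 'rV[R]_n * F) (B : R) :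
  (forall k, C (c k)) -> (forall k, k%:R < `|(c k).1|) ->
  (forall k, `|(c k).2| <= B) ->
  exists2 h : 'rV[R]_n, h <> 0 & horizon_cone C (h, 0).
Proof.
move=> Cc c1 c2.
have c1_gt0 k : 0 < `|(c k).1| by exact: le_lt_trans (c1 k).
pose u k := `|(c k).1|^-1 *: (c k).1.
have u1 k : `|u k| = 1.
  by rewrite normrZ normfV normr_id mulVf // gt_eqF.
have [|phi [h [phi_ge uh]]] := @bounded_cvg_subsequence R n u 1.
  by move=> k; rewrite u1.
have phi_oo := cvg_geq_id _ phi_ge.
have inv0 : `|(c k).1|^-1 @[k --> \oo] --> (0 : R).
  apply/gtr0_cvgV0; first exact: nearW.
  apply: (@ger_cvgy _ _ _ _ (fun k : nat => k%:R)); last exact: cvgr_idn.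
  by apply: nearW => k; exact/ltW/c1.
have lam0 : `|(c (phi k)).1|^-1 @[k --> \oo] --> (0 : R).
  exact: (cvg_comp _ _ phi_oo inv0).
exists h.
  move=> h0; move: uh => /cvg_norm; rewrite h0 normr0.
  under eq_cvg do rewrite u1.
  move=> one_to_0; have one0 : (1 : R) = 0.
    by apply: norm_cvg_unique one_to_0; exact: cvg_cst.
  by move/eqP: one0; rewrite oner_eq0.
right; exists (c \o phi), (fun k => `|(c (phi k)).1|^-1); split => //=.
- by move=> k; rewrite invr_gt0.
- suff c2_to_0 : `|(c (phi k)).1|^-1 *: (c (phi k)).2 @[k --> \oo] --> (0 : F).
    exact: (cvg_pair uh c2_to_0).
  apply/norm_cvg0P.
  have lamB : `|(c (phi k)).1|^-1 * B @[k --> \oo] --> (0 : R).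
    by rewrite -[X in _ --> X](mul0r B); apply: cvgMr_tmp.
  apply: (@squeeze_cvgr _ _ _ _ (cst 0) (fun k => `|(c (phi k)).1|^-1 * B));
    [|exact: cvg_cst|exact: lamB].
  apply: nearW => k /=.
  by rewrite normr_ge0 normrZ normfV normr_id ler_pM2l ?invr_gt0 ?c2.
Qed.

(** A set without nonzero horizon direction in R^n x {0} has bounded fibres, locally
    uniformly in the second component, so limits in the second component lift
    to the set by compactness. *)
Lemma closed_image_snd (R : realType) (n : nat) (F : normedModType R)
    (C : set ('rV[R]_n * F)) :
  closed C -> (forall h : 'rV[R]_n, horizon_cone C (h, 0) -> h = 0) ->
  closed (snd @` C).
Proof.
move=> Ccl hor s scl.
have [M Mx] : exists M, forall c, C c -> `|s - c.2| < 1 -> `|c.1| <= M.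
  apply: contrapT => /forallNP noM.
  have far (k : nat) : exists c, [/\ C c, `|s - c.2| < 1 & k%:R < `|c.1|].
    have /existsNP[c /not_implyP[Cc /not_implyP[sc /negP]]] := noM k%:R.
    by rewrite -ltNge => kc; exists c.
  have [c cP] := choice far.
  have [k|k|k|h h0 /hor//] := @horizon_cone_unbounded _ _ _ C c (1 + `|s|).
  - by have [] := cP k.
  - by have [] := cP k.
  - have [_ /ltW sc _] := cP k.
    rewrite -[(c k).2](subrK s) (le_trans (ler_normD _ _))//.
    by rewrite lerD2r distrC.
have near_s (k : nat) : exists c, C c /\ `|s - c.2| < k.+1%:R^-1.
  have [|_ [[c Cc <-]]] := scl (ball s k.+1%:R^-1).
    by apply: nbhsx_ballx; rewrite invr_gt0.
  by rewrite -ball_normE => sc; exists c.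
have [c cP] := choice near_s.
have [|phi [x [phi_ge xl]]] := @bounded_cvg_subsequence R n (fst \o c) M.
  move=> k; have [Cc sc] := cP k; apply: Mx => //; apply: (lt_le_trans sc).
  by rewrite invf_le1 // ler1n.
have c2s : (c k).2 @[k --> \oo] --> s.
  apply/cvgrPdist_lt => e e0; near=> k.
  have [_ /lt_trans] := cP k; apply.
  by near: k; exact: near_infty_natSinv_lt (PosNum e0).
have sl : (c (phi k)).2 @[k --> \oo] --> s.
  exact: (cvg_comp _ _ (cvg_geq_id _ phi_ge) c2s).
exists (x, s) => //.
have cl : ((c (phi k)).1, (c (phi k)).2) @[k --> \oo] --> (x, s).
  exact: (cvg_pair xl sl).
apply: (closed_cvg C Ccl _ (x, s) cl).
by apply: nearW => k /=; rewrite -surjective_pairing; have [] := cP (phi k).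
Unshelve. all: by end_near. Qed.

Lemma gph_GK (R : realType) (E F : normedModType R) (g : E -> F) (K : set F) :
  gph (GK g K) = [set p | K (g p.1 + p.2)].
Proof.
apply/seteqP; split=> [[x s] [k Kk /= <-]|[x s] Ks] /=; first by rewrite addNKr.
by exists (g x + s) => //; rewrite addKr.
Qed.

Theorem lemma2p1 (R : realType) (n : nat) (Y : finHilbertType R)
    (K : set Y) (f : 'rV[R]_n -> R) (g : 'rV[R]_n -> Y)
    (K_nonempty : K !=set0) (K_closed : closed K)
    (K_convex : @convex_set R Y K)
    (f_continuous : continuous f)
    (f_convex : @convex_function R 'rV[R]_n setT f)
    (g_continuous : continuous g)
    (GK_convex : graph_convex (GK g K))
    (GK_horizon : forall hx : 'rV[R]_n, horizon_map (GK g K) hx 0 -> hx = 0) :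
  closed (feasible_shifts g K).
Proof.
have -> : feasible_shifts g K = snd @` gph (GK g K).
  rewrite gph_GK; apply/seteqP; split=> [s [x Ks]|_ [[x s] Ks <-]].
    by exists (x, s).
  by exists x.
apply: closed_image_snd => //; rewrite gph_GK.
apply: (@preimage_closed _ _ (fun p : 'rV[R]_n * Y => g p.1 + p.2)) => // p _.
apply: cvgD; last exact: cvg_snd.
by apply: (cvg_comp _ _ cvg_fst); exact: g_continuous.
Qed.
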